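(* Let $k,m,d,a$ be positive integers. For each positive integer $n$, consider the $k$-dimensional chessboard of side length $n$ with $dn^{k-m}$ attacking pieces placed at random on it, where a piece, wherever it is placed, attacks $an^m$ spaces. Let $S_{n,k}$ be the number of safe spaces. Then the variance of the proportion of safe spaces $S_{n,k}/n^k$ (the random variable with mean $\mu_{n,k}$) approaches $0$ as $n\to\infty$.
   Context: The $k$-dimensional board of side length $n$ is the set of spaces $\{1,\dots,n\}^k$. For each $n$ the type of piece is given by an attack rule assigning to each space $p$ the set $A_n(p)$ of spaces attacked by a piece at $p$; the space $p$ itself is counted as attacked by the piece at $p$ (so $p\in A_n(p)$), and $|A_n(p)|=an^m$ for every $p$. ''Placing $N$ pieces at random'' means that the set of occupied spaces (the board configuration) is chosen uniformly among all subsets of $N$ distinct spaces; here $N=dn^{k-m}$ (and $n$ is taken large enough that this is possible). A space is safe under a board configuration if it lies in none of the sets $A_n(p)$ with $p$ occupied. $S_{n,k}$ is the number of safe spaces and $\mu_{n,k}=\mathbb{E}[S_{n,k}]/n^k$ is the expected proportion of safe spaces. *)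

(* Defs.v *)
From HB Require Import structures.
From mathcomp Require Import all_boot all_order all_algebra.
From mathcomp Require Import all_classical all_reals all_analysis.

Set Implicit Arguments.
Unset Strict Implicit.
Unset Printing Implicit Defensive.

Import Order.TTheory GRing.Theory Num.Theory.
Import numFieldNormedType.Exports.

Local Open Scope classical_set_scope.
Local Open Scope ring_scope.

Notation board k n := {ffun 'I_k -> 'I_n}.

(* An element is the set of occupied spaces.  The type carries the discrete
   sigma-algebra, so every function on it is a random variable. *)
Definition config (k n : nat) : Type := {set board k n}.
HB.instance Definition _ k n := Finite.copy (config k n) {set board k n}.
HB.instance Definition _ k n := isPointed.Build (config k n) finset.set0.
HB.instance Definition _ k n := @isMeasurable.Build default_measure_display
  (config k n) discrete_measurable discrete_measurable0
  (@discrete_measurableC _) (@discrete_measurableU _).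

Definition configs_of_size (k n N : nat) : set (config k n) :=
  [set c : config k n | #|c| = N].
Arguments configs_of_size : clear implicits.

Lemma measurable_configs_of_size (k n N : nat) :
  measurable (configs_of_size k n N).
Proof. by []. Qed.

(* Normalized counting measure on the configurations with N occupied spaces.
   The Dirac mass is only the default value required by [mnormalize]; it is
   used only if there is no such configuration, i.e. if n ^ k < N. *)
Definition random_config (R : realType) (k n N : nat) :
    probability (config k n) R :=
  mnormalize (mrestr (@counting (config k n) R)
                (measurable_configs_of_size k n N))
             (\d_ (finset.set0 : config k n)).

Definition attack_rule (k n : nat) : Type := board k n -> {set board k n}.

Definition safe_spaces (k n : nat) (A : attack_rule k n) (c : config k n) :
    {set board k n} :=
  [set x : board k n | [forall p in c, x \notin A p]]%SET.

Definition safe_proportion (R : realType) (k n : nat) (A : attack_rule k n)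
    (c : config k n) : R :=
  #|safe_spaces A c|%:R / (n ^ k)%:R.

(* Main.v *)
(* Write B x for the set of spaces attacking x, M = n ^ k, and N for the number
   of pieces.  Two spaces x, y are both safe with probability q #|B x :|: B y|,
   where q j = C(M - j, N) / C(M, N).  Since q (i + j) <= q i * q j and q
   decreases by at most N / M at each step, the covariance of the two events is
   at most (N / M) * #|B x :&: B y|.  Double counting turns the sum over x, y of
   #|B x :&: B y| into the sum over p of #|A p| ^ 2 = n ^ k * (a * n ^ m) ^ 2, so
   the variance is at most d * a ^ 2 * n ^ m / n ^ k, which settles m < k.
   If k <= m, every piece attacks the whole board and no space is safe. *)
Require Import Defs.
From mathcomp Require Import all_boot all_order all_algebra.
From mathcomp Require Import all_classical all_reals all_analysis.
From mathcomp Require Import zify ring.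
Import Order.TTheory GRing.Theory Num.Theory.
Import numFieldNormedType.Exports.

Set Implicit Arguments.
Unset Strict Implicit.
Unset Printing Implicit Defensive.

(** * Inequalities between binomial coefficients *)

Lemma bin_logconcave (M N b c : nat) :
  'C(M, N) * 'C(M - (b + c), N) <= 'C(M - b, N) * 'C(M - c, N).
Proof.
have [leM|ltM] := leqP (b + c) M; last first.
  have [N0|N_gt0] := posnP N; first by rewrite N0 !bin0.
  have -> : M - (b + c) = 0 by lia.
  by rewrite bin0n eqn0Ngt N_gt0 muln0.
have fac_gt0 : 0 < N`! * N`! by rewrite muln_gt0 fact_gt0.
(* Multiplying by N!^2 gives products of falling factorials, compared factor by factor: where no
   subtraction truncates, (M - b - i)(M - c - i) exceeds (M - i)(M - b - c - i) by b c. *)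
rewrite -(leq_pmul2r fac_gt0) !(mulnACA _ _ N`!) !bin_ffact.
rewrite !ffact_prod -!big_split /=.
by apply: leq_prod => i _; nia.
Qed.

(** Pascal's rule: lowering the upper index from v + 1 to v loses C(v, N - 1), which is at most C(M
    - 1, N - 1) since v < M. *)
Lemma bin_sub_lipschitz (M N u i : nat) : 0 < N ->
  'C(M - u, N) <= 'C(M - (u + i), N) + i * 'C(M.-1, N.-1).
Proof.
case: N => // N _ /=; elim: i => [|i IH]; first by rewrite addn0 mul0n addn0.
apply: (leq_trans IH); rewrite mulSn addnA leq_add2r addnS.
case E: (M - (u + i)) => [|v]; first by rewrite bin0n.
rewrite (_ : M - (u + i).+1 = v); last by lia.
by rewrite binS leq_add2l leq_bin2l //; lia.
Qed.

(** * Moments of the number of safe spaces, by counting *)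

Definition attackers (T : finType) (A : T -> {set T}) (x : T) : {set T} :=
  [set p | x \in A p].

(** [safe_spaces] over an arbitrary finite type; convertible to it on boards. *)
Definition safe_set (T : finType) (A : T -> {set T}) (c : {set T}) : {set T} :=
  [set x | [forall p in c, x \notin A p]].

Lemma in_safe_set (T : finType) (A : T -> {set T}) (c : {set T}) (x : T) :
  (x \in safe_set A c) = (c \subset ~: attackers A x).
Proof.
rewrite inE; apply/forall_inP/fintype.subsetP => H p /H; by rewrite !inE.
Qed.

Lemma sum_safe (T : finType) (A : T -> {set T}) (N : nat) :
  \sum_(c : {set T} | #|c| == N) #|safe_set A c| =
  \sum_x 'C(#|T| - #|attackers A x|, N).
Proof.
under [LHS]eq_bigr do rewrite -sum1_card big_mkcond.
rewrite exchange_big /=; apply: eq_bigr => x _.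
rewrite -(finset.setCK (attackers A x)) -cardsCs -cards_draws.
rewrite -big_mkcondr sum1_card -cardsE.
by apply: eq_card => c; rewrite !finset.in_set unfold_in /= in_safe_set andbC.
Qed.

(** The square counts pairs of safe spaces, and x, y are both safe exactly when [c] avoids the union
    of their attackers. *)
Lemma sum_safe_sqr (T : finType) (A : T -> {set T}) (N : nat) :
  \sum_(c : {set T} | #|c| == N) #|safe_set A c| ^ 2 =
  \sum_x \sum_y 'C(#|T| - #|attackers A x :|: attackers A y|, N).
Proof.
under [LHS]eq_bigr => c _.
  rewrite -mulnn -cardsX -sum1_card big_mkcond /=.
  over.
rewrite exchange_big /= [RHS]pair_big /=; apply: eq_bigr => -[x y] _ /=.
rewrite -(finset.setCK (_ :|: _)) -cardsCs -cards_draws.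
rewrite -big_mkcondr sum1_card -cardsE.
apply: eq_card => c; rewrite !finset.in_set unfold_in /= finset.in_setX /=.
by rewrite !in_safe_set finset.setCU finset.subsetI andbC.
Qed.

Lemma sum_attackers_setI (T : finType) (A : T -> {set T}) :
  \sum_x \sum_y #|attackers A x :&: attackers A y| = \sum_p #|A p| ^ 2.
Proof.
rewrite pair_big /=; under [LHS]eq_bigr do rewrite -sum1_card big_mkcond.
rewrite exchange_big /=; apply: eq_bigr => p _.
rewrite -mulnn -cardsX -sum1_card -big_mkcond /=.
by apply: eq_bigl => -[x y]; rewrite !inE.
Qed.

(** The variance bound with denominators cleared: dividing by M C(M, N)^2, where M = [#|T|], bounds
    the variance of the number of safe spaces by N / M times the last sum. *)
Lemma safe_second_moment (T : finType) (A : T -> {set T}) (N : nat) :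
  0 < N ->
  #|T| * 'C(#|T|, N) * (\sum_(c : {set T} | #|c| == N) #|safe_set A c| ^ 2) <=
  #|T| * (\sum_(c : {set T} | #|c| == N) #|safe_set A c|) ^ 2
  + 'C(#|T|, N) ^ 2 * N * \sum_p #|A p| ^ 2.
Proof.
move=> N_gt0; rewrite sum_safe sum_safe_sqr -sum_attackers_setI.
rewrite -mulnn !big_distrlr /= !big_distrr -big_split; apply: leq_sum => x _ /=.
rewrite !big_distrr -big_split; apply: leq_sum => y _ /=.
set bx := attackers A x; set b_y := attackers A y.
have := bin_logconcave #|T| N #|bx| #|b_y|.
(* Now both binomial lemmas involve the same term, with upper index M minus the sizes of the union
   and the intersection. *)
rewrite -(cardsUI bx b_y).
have := @bin_sub_lipschitz #|T| N #|bx :|: b_y| #|bx :&: b_y| N_gt0.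
(* This absorption identity is the source of the factor N / M. *)
have : #|T| * 'C(#|T|.-1, N.-1) = N * 'C(#|T|, N).
  by case: (N) N_gt0 => // n _; rewrite mul_bin_diag.
set M := #|T|; set C := 'C(M, N); set D := 'C(M.-1, _); set i := #|_ :&: _|.
move=> e1 /(leq_mul (leqnn (M * C))) h1 /(leq_mul (leqnn M)) h2.
apply: (leq_trans h1); rewrite mulnDr leq_add //; first by rewrite -mulnA.
have -> : M * C * (i * D) = M * D * (C * i) by lia.
by rewrite e1; lia.
Qed.

(** * Probabilities and expectations as finite sums *)

Local Open Scope classical_set_scope.
Local Open Scope ring_scope.

Lemma counting_finset (R : realType) (T : finType) (P : pred T) :
  counting [set x | P x] = #|P|%:R%:E :> \bar R.
Proof.
rewrite /counting asboolT; last exact: finite_finset.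
congr (_%:R%:E); rewrite cardE; apply/perm_size/uniq_perm.
- exact: finmap.fset_uniq.
- exact: enum_uniq.
- move=> x; rewrite mem_enum in_fset_set; last exact: finite_finset.
  by apply/idP/idP; rewrite inE.
Qed.

Lemma mnormalizeE d (T : measurableType d) (R : realType)
    (mu : {measure set T -> \bar R}) (P : probability T R) (U : set T) (r : R) :
  mu setT = r%:E -> r != 0 -> (mnormalize mu P U = mu U * r^-1%:E)%E.
Proof. by move=> muT r0; rewrite /mnormalize /= muT eqe (negPf r0). Qed.

Lemma card_board (k n : nat) : #|board k n : finType| = (n ^ k)%N.
Proof. by rewrite card_ffun !card_ord. Qed.

Lemma random_configE (R : realType) (k n N : nat) (P : pred (config k n)) :
  (N <= n ^ k)%N ->
  random_config R k n N [set c | P c] =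
  (#|[pred c : {set board k n} | P c & #|c| == N]|%:R / 'C(n ^ k, N)%:R)%:E.
Proof.
move=> leN.
have mE (Q : pred (config k n)) :
    mrestr (@counting (config k n) R)
      (measurable_configs_of_size k n N) [set c | Q c] =
    #|[pred c : {set board k n} | Q c & #|c| == N]|%:R%:E.
  rewrite /mrestr -counting_finset; congr (counting _).
  by apply/seteqP; split => c /=;
    [move=> [-> ->]; rewrite eqxx|move=> /andP[-> /eqP]].
have mT : mrestr (@counting (config k n) R)
      (measurable_configs_of_size k n N) setT = 'C(n ^ k, N)%:R%:E.
  rewrite [setT](_ : _ = [set c | predT c]); last first.
    by apply/seteqP; split.
  rewrite mE -card_board -card_draws -cardsE.
  by congr (_%:R%:E); apply: eq_card => c; rewrite !inE.
(* The total mass is nonzero, so the Dirac default is not reached. *)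
have C_gt0 : (0 < 'C(n ^ k, N))%N by rewrite bin_gt0.
rewrite /random_config /= (mnormalizeE _ _ mT) ?pnatr_eq0 -?lt0n // EFinM.
by congr (_ * _)%E; exact: mE.
Qed.

Lemma expectation_random_config (R : realType) (k n N : nat)
    (f : config k n -> R) : (N <= n ^ k)%N -> (forall c, 0 <= f c) ->
  ('E_(random_config R k n N)[f] =
   ((\sum_(c : {set board k n} | #|c| == N) f c) / 'C(n ^ k, N)%:R)%:E)%E.
Proof.
move=> leN f0; rewrite unlock.
(* Writing [f] as a combination of indicators of singletons reduces the integral to point masses. *)
have fE (x : config k n) : (f x)%:E =
    (\sum_(c <- enum {: config k n}) (f c)%:E * (\1_[set y | y == c] x)%:E)%E.
  rewrite big_enum /= (bigD1 x) //= indicE mem_set //= mule1.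
  rewrite big1 ?adde0 // => c nc; rewrite indicE memNset ?mule0 //=.
  by apply/negP; rewrite eq_sym.
under eq_integral do rewrite fE.
rewrite ge0_integral_sum //; last first.
  by move=> c x _; rewrite -EFinM lee_fin mulr_ge0.
under eq_bigr => c _.
  rewrite ge0_integralZl_EFin //.
  rewrite integral_indic // setIT.
  rewrite [X in (_ * X)%E](random_configE R (pred1 c) leN) -EFinM.
  over.
rewrite sumEFin big_enum /=; congr EFin.
rewrite mulr_suml [RHS]big_mkcond /=; apply: eq_bigr => c _.
case: ifPn => cN.
  rewrite (eq_card (B := pred1 c)) ?card1 ?mul1r //.
  by move=> y; rewrite !inE; case: eqP => // ->.
rewrite (eq_card (B := pred0)) ?card0 ?mul0r ?mulr0 //.
by move=> y; rewrite !inE; case: eqP => // ->; apply/negbTE.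
Qed.

(** * Bounds on the variance *)

Lemma variance_safe_proportion_le (R : realType) (k n N : nat)
    (A : attack_rule k n) : (0 < N <= n ^ k)%N ->
  ('V_(random_config R k n N)[safe_proportion R A] <=
   ((N * \sum_p #|A p| ^ 2)%N%:R / (n ^ k)%:R ^+ 3)%:E)%E.
Proof.
move=> /andP[N_gt0 leN].
have M_gt0 : (0 < n ^ k)%N by apply: leq_trans leN.
have C_gt0 : (0 < 'C(n ^ k, N))%N by rewrite bin_gt0.
have M0 : (n ^ k)%:R != 0 :> R by rewrite pnatr_eq0 -lt0n.
have C0 : 'C(n ^ k, N)%:R != 0 :> R by rewrite pnatr_eq0 -lt0n.
have := safe_second_moment A N_gt0.
rewrite card_board.
set s1 := (\sum_(c | _) #|safe_set _ c|)%N.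
set s2 := (\sum_(c | _) #|safe_set _ c| ^ 2)%N.
set q := (\sum_p #|A p| ^ 2)%N => moment.
have cardC : \sum_(c : {set board k n} | #|c| == N) (1 : R)
    = 'C(n ^ k, N)%:R.
  rewrite -card_board -card_draws -sumr_const.
  by apply: eq_bigl => c; rewrite inE.
rewrite /variance unlock expectation_random_config //; last first.
  by move=> c; exact: sqr_ge0.
rewrite expectation_random_config //; last first.
  by move=> c; rewrite /safe_proportion divr_ge0 ?ler0n.
have -> : \sum_(c : {set board k n} | #|c| == N) safe_proportion R A c =
    s1%:R / (n ^ k)%:R by rewrite natr_sum mulr_suml.
set e := fine _.
have eE : e = s1%:R / (n ^ k)%:R / 'C(n ^ k, N)%:R by [].
rewrite lee_fin.
have -> : \sum_(c : {set board k n} | #|c| == N)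
    ((safe_proportion R A \- cst e) * (safe_proportion R A \- cst e)) c =
    s2%:R / (n ^ k)%:R ^+ 2 - e * 2 / (n ^ k)%:R * s1%:R
    + e ^+ 2 * 'C(n ^ k, N)%:R.
  rewrite -cardC /s1 /s2 2!natr_sum mulr_suml !mulr_sumr.
  rewrite -sumrB -big_split /=; apply: eq_bigr => c _.
  rewrite natrX -[safe_set A c]/(safe_spaces A c).
  by rewrite !fctE /safe_proportion /=; field.
rewrite -subr_ge0.
(* The gap is the slack in [moment] over a positive denominator. The cube is M^2 from scaling the
   variance and M from N / M. *)
have -> : (N * q)%:R / (n ^ k)%:R ^+ 3 -
   (s2%:R / (n ^ k)%:R ^+ 2 - e * 2 / (n ^ k)%:R * s1%:R +
    e ^+ 2 * 'C(n ^ k, N)%:R) / 'C(n ^ k, N)%:R =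
   ((n ^ k * s1 ^ 2 + 'C(n ^ k, N) ^ 2 * N * q)%:R
    - (n ^ k * 'C(n ^ k, N) * s2)%:R)
   / ((n ^ k)%:R ^+ 3 * 'C(n ^ k, N)%:R ^+ 2) :> R.
  by rewrite eE natrD !natrM; field; apply/andP.
rewrite divr_ge0 ?mulr_ge0 ?exprn_ge0 // subr_ge0 ler_nat.
exact: moment.
Qed.

(** Treated apart because the general bound only gives N here. As N > 0, every configuration of size
    N is nonempty and leaves no safe space. *)
Lemma variance_safe_proportion_full (R : realType) (k n N : nat)
    (A : attack_rule k n) : (0 < N <= n ^ k)%N ->
  (forall p, A p = finset.setT) ->
  ('V_(random_config R k n N)[safe_proportion R A] = 0)%E.
Proof.
move=> /andP[N_gt0 leN] AT.
have X0 (c : {set board k n}) : #|c| == N -> safe_proportion R A c = 0.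
  move=> /eqP cN; have /finset.set0Pn[p pc] : c != finset.set0.
    by rewrite -card_gt0 cN.
  rewrite /safe_proportion (_ : safe_spaces A c = finset.set0).
    by rewrite cards0 mul0r.
  apply/setP => x; rewrite !inE; apply/negbTE/forall_inPn.
  by exists p; rewrite // AT inE.
rewrite /variance unlock expectation_random_config //; last first.
  by move=> c; exact: sqr_ge0.
rewrite expectation_random_config //; last first.
  by move=> c; rewrite /safe_proportion divr_ge0 ?ler0n.
rewrite [in fine _]big1 // mul0r /= big1 ?mul0r // => c /X0 c0.
by rewrite !fctE /= c0 subr0 mul0r.
Qed.

(** * Passage to the limit *)

Theorem theorem1p4 (R : realType) (k m d a : nat)
  (hk : (0 < k)%N) (hm : (0 < m)%N) (hd : (0 < d)%N) (ha : (0 < a)%N)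
  (A : forall n : nat, attack_rule k n)
  (hA : \forall n \near \oo, forall p : board k n,
      p \in A n p /\ #|A n p| = (a * n ^ m)%N) :
  'V_(random_config R k n (d * n ^ (k - m)))[safe_proportion R (A n)]
    @[n --> \oo] --> 0%E.
Proof.
(* [harmonic n] is 1 / (n + 1); the doubling pays for 1 / n <= 2 / (n + 1). *)
pose u (n : nat) : \bar R := (((d * a ^ 2).*2%:R : R)%:E * (harmonic n)%:E)%E.
apply: (@squeeze_cvge _ _ _ R (cst 0%E) _ u); last 2 first.
- exact: cvg_cst.
- rewrite -[X in _ --> X](mule0 ((d * a ^ 2).*2%:R : R)%:E).
  by apply: cvgeZl => //; exact: cvge_harmonic.
near=> n.
have An : forall p : board k n, p \in A n p /\ #|A n p| = (a * n ^ m)%N.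
  by near: n.
have dn : (d <= n)%N by near: n; exact: nbhs_infty_ge.
have n_gt1 : (1 < n)%N by near: n; exact: nbhs_infty_ge.
have n_gt0 : (0 < n)%N by exact: ltnW.
have N_gt0 : (0 < d * n ^ (k - m))%N by rewrite muln_gt0 hd expn_gt0 n_gt0.
(* [d <= n] absorbs [d] into one more power of n; (k - m) + 1 <= k holds even if k - m truncates to
   0, since k and m are positive. *)
have leN : (d * n ^ (k - m) <= n ^ k)%N.
  apply: (@leq_trans (n ^ (k - m).+1)); last first.
    by rewrite leq_exp2l //; lia.
  by rewrite expnS leq_mul2r dn orbT.
have N_bounds : (0 < d * n ^ (k - m) <= n ^ k)%N by rewrite N_gt0.
rewrite variance_ge0 /=.
have [lemk|ltkm] := leqP k m.
  rewrite variance_safe_proportion_full //.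
    by rewrite /u -EFinM lee_fin mulr_ge0 ?harmonic_ge0.
  move=> p; apply/eqP; rewrite eqEcard finset.subsetT cardsT card_board.
  have [_ ->] := An p; apply: (@leq_trans (n ^ m)); first by rewrite leq_exp2l.
  by rewrite leq_pmull.
apply: (le_trans (variance_safe_proportion_le R (A n) N_bounds)).
rewrite /u -EFinM lee_fin.
have -> : (\sum_p #|A n p| ^ 2 = n ^ k * (a ^ 2 * (n ^ m) ^ 2))%N.
  rewrite (eq_bigr (fun=> a ^ 2 * (n ^ m) ^ 2)%N).
    by rewrite sum_nat_const card_board.
  by move=> p _; have [_ ->] := An p; rewrite expnMn.
have kE : k = (m + (k - m))%N by lia.
have nk : n%:R ^+ k = n%:R ^+ m * n%:R ^+ (k - m) :> R.
  by rewrite [in LHS]kE exprD.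
have n0 : n%:R != 0 :> R by rewrite pnatr_eq0 -lt0n.
have zn : (n%:R <= n%:R ^+ (k - m) :> R).
  by rewrite -natrX ler_nat -[X in (X <= _)%N]expn1 leq_exp2l //; lia.
rewrite -mul2n !(natrM, natrX) nk /harmonic /=.
move: zn; set y := n%:R ^+ m; set z := n%:R ^+ (k - m) => zn.
have y0 : y != 0 by rewrite expf_neq0.
have z0 : z != 0 by rewrite expf_neq0.
have nz_gt0 : 0 < n%:R :> R by rewrite ltr0n.
(* The bound is d z (y z) (a y)^2 / (y z)^3. *)
rewrite (_ : _ / _ = d%:R * a%:R ^+ 2 * z^-1); last by field; apply/andP.
rewrite [leRHS](_ : _ = d%:R * a%:R ^+ 2 * (2 / n.+1%:R)); last first.
  by rewrite [RHS]mulrA; congr (_ / _); ring.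
rewrite ler_wpM2l ?mulr_ge0 ?exprn_ge0 //.
apply: (@le_trans _ _ n%:R^-1).
  by rewrite lef_pV2 ?posrE ?(lt_le_trans _ zn).
rewrite ler_pdivlMr ?ltr0Sn // mulrC ler_pdivrMr // -natrM ler_nat.
by lia.
Unshelve. all: by end_near.
Qed.
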